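(* Let $m,n\ge 1$, and let $A=(A^{(1)},\dots,A^{(m)})$ and $B=(B^{(1)},\dots,B^{(m)})$ be two $m$-tuples of diagonalizable $n\times n$ complex matrices such that the matrices $A^{(1)},\dots,A^{(m)}$ commute with each other and the matrices $B^{(1)},\dots,B^{(m)}$ commute with each other. Let $P$ and $Q$ be non-singular $n\times n$ complex matrices that simultaneously diagonalize $A$ and $B$ respectively, i.e. for all $k=1,\dots,m$, $$PA^{(k)}P^{-1}=\operatorname{diag}\left(\alpha_1^{(k)},\dots,\alpha_n^{(k)}\right),\qquad QB^{(k)}Q^{-1}=\operatorname{diag}\left(\beta_1^{(k)},\dots,\beta_n^{(k)}\right),$$ so that $\alpha_j=(\alpha_j^{(1)},\dots,\alpha_j^{(m)})$ and $\beta_j=(\beta_j^{(1)},\dots,\beta_j^{(m)})$, $j=1,\dots,n$, are the joint eigenvalues of $A$ and $B$ respectively. If each $A^{(k)}$, $k=1,\dots,m$, is non-singular, then there exists a permutation $\pi$ of $\{1,\dots,n\}$ such that $$\sum_{j=1}^n\sum_{k=1}^m\left|\frac{\alpha_j^{(k)}-\beta_{\pi(j)}^{(k)}}{\alpha_j^{(k)}}\right|^2\le\kappa(P)^2\,\kappa(Q)^2\sum_{k=1}^m\left\|(A^{(k)})^{-1}\left(B^{(k)}-A^{(k)}\right)\right\|_F^2 .$$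
   Context: $\|\cdot\|_F$ denotes the Frobenius norm and $\|\cdot\|$ the usual operator norm (induced by the Euclidean norm on $\mathbb{C}^n$). For an invertible matrix $X$, $\kappa(X)=\|X\|\,\|X^{-1}\|$ is its condition number. A joint eigenvalue of a tuple $A=(A^{(1)},\dots,A^{(m)})$ of commuting $n\times n$ complex matrices is an element $\lambda=(\lambda^{(1)},\dots,\lambda^{(m)})\in\mathbb{C}^m$ such that there is a non-zero vector $x\in\mathbb{C}^n$ with $A^{(j)}x=\lambda^{(j)}x$ for all $j=1,\dots,m$. No commutation between the $A^{(k)}$ and the $B^{(l)}$ is assumed. *)

(* Defs.v *)
From HB Require Import structures.
From mathcomp Require Import all_boot all_order all_algebra all_fingroup.
From mathcomp Require Import classical_sets reals.
From mathcomp Require Import complex.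

Set Implicit Arguments.
Unset Strict Implicit.
Unset Printing Implicit Defensive.

Import Order.TTheory GRing.Theory Num.Theory.
Import complex.ComplexField.Normc.

Local Open Scope classical_set_scope.
Local Open Scope ring_scope.

(* [normc z] is the modulus of [z : R[i]] as an element of [R], whereas the
   generic [`|z|] lives in [R[i]]. *)
Definition frob_norm (R : realType) (m n : nat) (A : 'M[R[i]]_(m, n)) : R :=
  Num.sqrt (\sum_(i < m) \sum_(j < n) normc (A i j) ^+ 2).

Definition eucl_norm (R : realType) (n : nat) (x : 'cV[R[i]]_n) : R :=
  Num.sqrt (\sum_(i < n) normc (x i 0) ^+ 2).

(* [sup] is 0 on sets without a supremum; see [has_sup_op_norm] below. *)
Definition op_norm (R : realType) (m n : nat) (A : 'M[R[i]]_(m, n)) : R :=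
  sup [set eucl_norm (A *m x) | x in [set x : 'cV[R[i]]_n | eucl_norm x <= 1]].

Definition cond_number (R : realType) (n : nat) (X : 'M[R[i]]_n) : R :=
  op_norm X * op_norm (invmx X).

Definition joint_eigenvalue (R : realType) (m n : nat)
    (A : 'I_m -> 'M[R[i]]_n) (lambda : 'I_m -> R[i]) : Prop :=
  exists2 x : 'cV[R[i]]_n, x != 0 & forall k, A k *m x = lambda k *: x.

Lemma normc_ge0 (R : realType) (z : R[i]) : 0 <= normc z.
Proof. by case: z => a b; exact: sqrtr_ge0. Qed.

Lemma normc_sum_le (R : realType) (n : nat) (F : 'I_n -> R[i]) :
  normc (\sum_i F i) <= \sum_i normc (F i).
Proof.
elim/big_ind2: _ => [|x a y b xa yb|//]; first by rewrite normc0.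
by apply: le_trans (lerD xa yb); exact: le_normcD.
Qed.

Lemma has_sup_op_norm (R : realType) (m n : nat) (A : 'M[R[i]]_(m, n)) :
  has_sup [set eucl_norm (A *m x) | x in [set x : 'cV[R[i]]_n | eucl_norm x <= 1]].
Proof.
split.
  exists (eucl_norm (A *m 0)), 0 => //=.
  rewrite /eucl_norm big1 ?sqrtr0 ?ler01// => i _.
  by rewrite mxE normc0 expr0n.
exists (Num.sqrt (\sum_i (\sum_j normc (A i j)) ^+ 2)) => _ [x /= x1 <-].
have x2 : \sum_i normc (x i 0) ^+ 2 <= 1.
  rewrite -(@expr1n R 2) -(sqr_sqrtr (sumr_ge0 _ _)).
    by rewrite lerXn2r// nnegrE ?sqrtr_ge0.
  by move=> i _; rewrite exprn_ge0// normc_ge0.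
have xj j : normc (x j 0) <= 1.
  rewrite -(@ler_pXn2r _ 2)// ?nnegrE ?normc_ge0// expr1n.
  apply: le_trans x2; rewrite (bigD1 j)//= lerDl sumr_ge0// => i _.
  by rewrite exprn_ge0// normc_ge0.
rewrite /eucl_norm ler_wsqrtr// ler_sum// => i _.
rewrite lerXn2r ?nnegrE ?normc_ge0//; first by rewrite sumr_ge0// => j _; exact: normc_ge0.
rewrite mxE; apply: le_trans (normc_sum_le _) _.
apply: ler_sum => j _; rewrite normcM.
by rewrite ler_piMr ?normc_ge0.
Qed.

Lemma joint_eigenvalueP (R : realType) (m n : nat) (A : 'I_m -> 'M[R[i]]_n)
    (P : 'M[R[i]]_n) (alpha : 'I_m -> 'I_n -> R[i]) (lambda : 'I_m -> R[i])
    (hP : P \in unitmx)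
    (hA : forall k, P *m A k *m invmx P = diag_mx (\row_j alpha k j)) :
  joint_eigenvalue A lambda <-> exists j, forall k, lambda k = alpha k j.
Proof.
have PA k : P *m A k = diag_mx (\row_j alpha k j) *m P by rewrite -hA mulmxKV.
split=> [[x x0 Ax]|[j lj]].
  have [j yj] : exists j, (P *m x) j 0 != 0.
    apply/existsP; apply: contraNT x0; rewrite negb_exists => /forallP y0.
    rewrite -[x](mulKmx hP); apply/eqP.
    suff -> : P *m x = 0 by rewrite mulmx0.
    by apply/matrixP => i k; rewrite ord1 [RHS]mxE; exact/eqP/negPn/y0.
  exists j => k; apply: (mulIf yj).
  have /matrixP/(_ j 0) : P *m (A k *m x) = lambda k *: (P *m x).
    by rewrite Ax scalemxAr.
  by rewrite mulmxA PA -mulmxA mul_diag_mx !mxE => ->.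
exists (invmx P *m delta_mx j 0).
  apply/eqP => /(congr1 (mulmx P)); rewrite mulKVmx// mulmx0.
  by move=> /matrixP/(_ j 0)/eqP; rewrite !mxE !eqxx oner_eq0.
move=> k; rewrite -[A k](mulKmx hP) PA -!mulmxA mulKVmx// scalemxAr.
congr (_ *m _); rewrite mul_diag_mx; apply/matrixP => i l.
by rewrite !mxE lj; case: eqP => [->|_]; rewrite /= ?mulr0.
Qed.

(* Main.v *)
Require Import Defs.
From HB Require Import structures.
From mathcomp Require Import all_boot all_order all_algebra all_fingroup.
From mathcomp Require Import classical_sets reals.
From mathcomp Require Import complex.
From mathcomp Require Import ring lra zify.

(* Put W = P Q^-1 and X_k = P (A_k^-1 (B_k - A_k)) Q^-1. Then X_k i j is
   (beta_j^(k) - alpha_i^(k)) / alpha_i^(k) * W i j, so the sum over k of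
   |X_k|_F^2 is the sum over i, j of c i j * |W i j|^2, where c i j is the
   squared relative distance between alpha_i and beta_j. With
   tau = |Q| |P^-1| we have |x| <= tau |W x|, hence every I x J block of the
   matrix tau^2 |W i j|^2 has sum at least |I| + |J| - n: the vectors supported
   on J that W maps to vectors supported on I form a space of at least that
   dimension, and an orthonormal basis of it witnesses the bound.
   These block bounds force the pairing with c to be at least the optimal
   assignment cost: by linear programming duality that cost is
   sum a_i + sum b_j for some a, b with a_i + b_j <= c i j, and
   max 0 (a_i + b_j) decomposes into layers supported on blocks. *)

Set Implicit Arguments.
Unset Strict Implicit.
Unset Printing Implicit Defensive.

Import Order.TTheory GRing.Theory Num.Theory.
Import complex.ComplexField.Normc.

Local Open Scope ring_scope.

(** * Shortest walks, potentials and duality for the assignment problem *)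

Section Potential.
Variables (R : realType) (T : finType) (d : T -> T -> R).

Fixpoint walk_cost (x : T) (s : seq T) : R :=
  if s is y :: s' then d x y + walk_cost y s' else 0.

Lemma walk_cost_cat x s t :
  walk_cost x (s ++ t) = walk_cost x s + walk_cost (last x s) t.
Proof. by elim: s x => [|y s IH] x /=; rewrite ?add0r// IH addrA. Qed.

(** In a walk without repetition each vertex determines its predecessor, so the cost becomes a sum
    over vertices, ready to be compared with a sum along a permutation. *)
Lemma walk_cost_uniq x s : uniq s ->
  walk_cost x s = \sum_(y <- s) d (nth x (x :: s) (index y s)) y.
Proof.
elim: s x => [|z s IH] x /=; first by rewrite big_nil.
move=> /andP[zs us]; rewrite big_cons /= eqxx /= (IH _ us); congr (_ + _).
apply: eq_big_seq => y ys; have /negPf -> /= : z != y by rewrite eq_sym (memPn zs).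
by rewrite (set_nth_default x)//= ltnS ltnW// index_mem.
Qed.

Lemma not_uniq_split (s : seq T) : ~~ uniq s ->
  exists s1 y s2 s3, s = s1 ++ y :: s2 ++ y :: s3.
Proof.
elim: s => //= z s IH; rewrite negb_and negbK.
have [zs _|_ /IH[s1 [y [s2 [s3 ->]]]]] := boolP (z \in s).
  by case/splitPr: zs => s2 s3; exists [::], z, s2, s3.
by exists (z :: s1), y, s2, s3.
Qed.

Hypothesis d0 : forall i, d i i = 0.
Hypothesis d_perm : forall u : {perm T}, 0 <= \sum_i d i (u i).

(** Strong induction on the length: a repeated vertex cuts the walk into two shorter closed walks,
    and a walk without repetition is a cycle of a permutation fixing all other points, where [d]
    vanishes. *)
Lemma closed_walk_cost_ge0 x s : last x s = x -> 0 <= walk_cost x s.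
Proof.
have [k] := ubnP (size s); elim: k x s => // k IH x s sk lx.
have [us|] := boolP (uniq s); last first.
  move=> /not_uniq_split[s1 [y [s2 [s3 es]]]]; move: sk lx; rewrite es.
  rewrite !(size_cat, last_cat)/= !size_cat/= => sk.
  rewrite last_cat/= => lx.
  have c1 : 0 <= walk_cost y (s2 ++ [:: y]).
    by apply: IH; rewrite ?last_cat// size_cat/=; lia.
  have c2 : 0 <= walk_cost x (s1 ++ y :: s3).
    by apply: IH; rewrite ?last_cat// size_cat/=; lia.
  apply: le_trans (addr_ge0 c1 c2) _.
  rewrite le_eqVlt; apply/orP; left; apply/eqP.
  by rewrite !walk_cost_cat /= !walk_cost_cat /=; ring.
case: s us lx {sk} => [//|y s] us lx.
have inj : injective (prev (y :: s)) by exact: can_inj (next_prev us).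
(* [prev] runs against the walk, so its inverse is used; reindexing by [prev] then gives the terms
   [d (prev i) i]. *)
have := d_perm (perm inj)^-1.
rewrite (reindex_inj (@perm_inj _ (perm inj))) /=.
under eq_bigr do rewrite permK permE.
rewrite (bigID (mem (y :: s))) /= [X in _ + X]big1 ?addr0; last first.
  move=> i /negPf ni; have := prev_nth (y :: s) i; rewrite ni /= => ->.
  exact: d0.
rewrite -big_uniq//= big_cons /=.
move: us => /= /andP[ys us]; rewrite (walk_cost_uniq _ us).
have -> : prev_at y y y s = x.
  have := prev_nth (y :: s) y; rewrite mem_head/= => ->.
  by rewrite memNindex// nth_last.
move=> /le_trans; apply; rewrite le_eqVlt; apply/orP; left; apply/eqP.
congr (_ + _); apply: eq_big_seq => z zs; congr (d _ _).
have := prev_nth (y :: s) z; rewrite inE zs orbT /= => ->//.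
Qed.

(* The potential of j is the least cost of a walk from r to j. *)
Lemma potential_exists (r : T) :
  exists p : T -> R, forall i j, p j <= p i + d i j.
Proof.
pose E j := [set walk_cost r s | s in [set s | last r s = j]]%classic.
have hE j : has_inf (E j).
  split; first by exists (walk_cost r [:: j]), [:: j].
  (* A step from [j] back to [r] closes the walk, which bounds its cost from below. *)
  exists (- d j r) => _ [s /= ls <-].
  have /closed_walk_cost_ge0 : last r (rcons s r) = r by rewrite last_rcons.
  by rewrite -cats1 walk_cost_cat ls /= addr0; lra.
exists (fun j => inf (E j)) => i j.
rewrite -lerBlDr; apply: lb_le_inf; first by case: (hE i).
move=> _ [s /= ls <-]; rewrite lerBlDr.
apply: ge_inf; first by case: (hE j).
by exists (rcons s j); rewrite /= ?last_rcons// -cats1 walk_cost_cat ls /= addr0.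
Qed.

End Potential.

(* For an optimal u, the reduced costs c i (u j) - c i (u i) admit a potential,
   because composing u with a permutation cannot lower its cost. *)
Lemma assignment_duality (R : realType) (T : finType) (c : T -> T -> R) :
  exists (u : {perm T}) (a b : T -> R),
    (forall i j, a i + b j <= c i j) /\
    \sum_i c i (u i) = \sum_i a i + \sum_i b i.
Proof.
have [r|T0] := pickP (@predT T); last first.
  exists 1%g, (fun=> 0), (fun=> 0); split=> [i|]; first by have := T0 i.
  by rewrite !big_pred0// addr0.
move=> _.
pose f (u : {perm T}) := \sum_i c i (u i).
have [u _ umin] := @arg_minP _ _ _ 1%g xpredT f isT.
pose d i j := c i (u j) - c i (u i).
have [] := @potential_exists _ _ d _ _ r.
- by move=> i; rewrite /d subrr.
- move=> v; rewrite sumrB subr_ge0.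
  have := umin (v * u)%g isT; rewrite /f.
  by under [leRHS]eq_bigr do rewrite permM.
(* With these dual variables, feasibility at [i], [j] is the potential inequality from [i] to
   [u^-1 j], and the potential cancels in the total. *)
move=> p hp; exists u, (fun i => c i (u i) - p i), (fun j => p (u^-1%g j)).
split=> [i j|].
  have := hp i (u^-1%g j); rewrite /d permKV; lra.
rewrite [X in _ + X](reindex_inj (@perm_inj _ u)) /=.
under [X in _ + X]eq_bigr do rewrite permK.
by rewrite -big_split /=; apply: eq_bigr => i _; rewrite subrK.
Qed.

(** * From block inequalities to a bound on the assignment cost *)

Section BlockSums.
Variables (R : realType) (T : finType) (s : T -> T -> R).
Hypothesis block_ge : forall I J : {set T},
  #|I|%:R + #|J|%:R - #|T|%:R <= \sum_(i in I) \sum_(j in J) s i j.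

(* Induction on the list of values: raising the lowest level m to the next one
   m' costs (m' - m) times the block inequality for {x > m} x {y <= m}. *)
Lemma block_layers (m : R) (ts : seq R) (x y : T -> R) :
  path <=%R m ts -> (forall i, x i \in m :: ts) -> (forall i, y i \in m :: ts) ->
  \sum_i x i - \sum_i y i <= \sum_i \sum_j s i j * Num.max 0 (x i - y j).
Proof.
elim: ts m x y => [|m' ts IH] m x y.
  move=> _ hx hy.
  have ex i : x i = m by have := hx i; rewrite inE => /eqP.
  have ey i : y i = m by have := hy i; rewrite inE => /eqP.
  under eq_bigr do rewrite ex.
  under [X in _ - X]eq_bigr do rewrite ey.
  rewrite subrr sumr_ge0// => i _; rewrite sumr_ge0// => j _.
  by rewrite ex ey subrr maxxx mulr0.
move=> /= /andP[mm' pts] hx hy.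
pose up (t : R) := Num.max t m'.
have ge_m' t : t \in m' :: ts -> m' <= t.
  rewrite inE => /predU1P[->//|].
  by have /allP := order_path_min le_trans pts; apply.
have val t : t \in m :: m' :: ts -> t = m \/ m' <= t.
  by rewrite in_cons => /predU1P[->|/ge_m']; [left|right].
have upP t : t \in m :: m' :: ts -> up t \in m' :: ts.
  rewrite /up in_cons => /predU1P[->|tin]; first by rewrite (max_idPr mm') mem_head.
  by rewrite (max_idPl (ge_m' _ tin)).
have := IH m' (up \o x) (up \o y) pts (fun i => upP _ (hx i)) (fun i => upP _ (hy i)).
(* Passing from [x], [y] to [up x], [up y] lowers the positive part of [x i - y j] by [m' - m] on
   [I] x [J] and leaves it unchanged elsewhere. *)
pose I := [set i | m < x i]; pose J := [set j | y j <= m].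
have dm : 0 <= m' - m by rewrite subr_ge0.
have := ler_wpM2l dm (block_ge I J).
have xE i : x i = up (x i) - (m' - m) + (m' - m) * (i \in I)%:R.
  rewrite /up inE; case: (val _ (hx i)) => [->|h].
    by rewrite ltxx (max_idPr mm') mulr0 addr0 subKr.
  rewrite (max_idPl h); by case: ltP => h'; rewrite ?mulr1n ?mulr0n ?mulr1 ?mulr0; lra.
have yE i : y i = up (y i) - (m' - m) * (i \in J)%:R.
  rewrite /up inE; case: (val _ (hy i)) => [->|h].
    by rewrite lexx (max_idPr mm') mulr1 subKr.
  rewrite (max_idPl h); by case: leP => h'; rewrite ?mulr1n ?mulr0n ?mulr1 ?mulr0; lra.
have sE i j : s i j * Num.max 0 (x i - y j) =
    s i j * Num.max 0 (up (x i) - up (y j)) +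
    (m' - m) * ((i \in I)%:R * ((j \in J)%:R * s i j)).
  suff -> : Num.max 0 (x i - y j) = Num.max 0 (up (x i) - up (y j)) +
    (m' - m) * ((i \in I)%:R * (j \in J)%:R) by ring.
  rewrite /up !inE.
  have [ex|h] := val _ (hx i); have [ey|h'] := val _ (hy j).
  - by rewrite ex ey !subrr maxxx ltxx mul0r mulr0 addr0.
  - rewrite ex ltxx mul0r mulr0 addr0 (max_idPr mm') (max_idPl h').
    by rewrite !max_l//; lra.
  - rewrite ey lexx (max_idPr mm') (max_idPl h).
    rewrite !max_r; try lra.
    by case: ltP => ?; rewrite ?mulr1n ?mulr0n ?mulr1 ?mulr0; lra.
  - rewrite (max_idPl h) (max_idPl h').
    by case: ltP => ?; case: leP => ?; rewrite ?mulr1n ?mulr0n ?mulr1 ?mulr0; lra.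
have cardE (K : {set T}) : \sum_i (i \in K)%:R = #|K|%:R :> R.
  by rewrite -sum1_card natr_sum [RHS]big_mkcond; apply: eq_bigr => i _; case: ifP.
have SxE : \sum_i x i = \sum_i up (x i) - (m' - m) * #|T|%:R + (m' - m) * #|I|%:R.
  rewrite (eq_bigr _ (fun i _ => xE i)) big_split sumrB /= -mulr_sumr cardE.
  by rewrite sumr_const !mulr_natr.
have SyE : \sum_i y i = \sum_i up (y i) - (m' - m) * #|J|%:R.
  by rewrite (eq_bigr _ (fun i _ => yE i)) sumrB /= -mulr_sumr cardE.
have SsE : \sum_i \sum_j s i j * Num.max 0 (x i - y j) =
    \sum_i \sum_j s i j * Num.max 0 (up (x i) - up (y j)) +
    (m' - m) * \sum_(i in I) \sum_(j in J) s i j.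
  rewrite [in RHS](big_mkcond (mem I)) mulr_sumr -big_split.
  apply: eq_bigr => i _; under eq_bigr do rewrite sE.
  rewrite big_split -!mulr_sumr /=; congr (_ + _ * _).
  rewrite [in RHS]big_mkcond; case: ifP => _; rewrite ?mul0r// mul1r.
  by apply: eq_bigr => j _; case: ifP => _; rewrite ?mul0r ?mul1r.
rewrite SxE SyE SsE /=; lra.
Qed.

Lemma block_weight_ge (a b : T -> R) :
  \sum_i a i + \sum_i b i <= \sum_i \sum_j s i j * Num.max 0 (a i + b j).
Proof.
pose ts := sort <=%R ([seq a i | i : T] ++ [seq - b i | i : T]).
have tsa i : a i \in ts by rewrite mem_sort mem_cat map_f ?mem_enum.
have tsb i : - b i \in ts.
  by rewrite mem_sort mem_cat (map_f (fun i => - b i)) ?mem_enum ?orbT.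
have := sort_sorted (@le_total _ R) ([seq a i | i : T] ++ [seq - b i | i : T]).
rewrite -/ts; case: ts tsa tsb => [|m ts] tsa tsb pts.
  (* Without levels there is no index, so both sums are empty. *)
  by rewrite !big1 ?addr0// => i; have := tsa i.
have := block_layers pts tsa tsb; rewrite sumrN opprK => /le_trans; apply.
by under eq_bigr do under eq_bigr do rewrite opprK.
Qed.

(** Dual feasibility and [0 <= c i j] give [Num.max 0 (a i + b j) <= c i j]; nonnegative weights [s]
    preserve this in the sum. *)
Lemma assignment_le_pairing (c : T -> T -> R) :
  (forall i j, 0 <= s i j) -> (forall i j, 0 <= c i j) ->
  exists u : {perm T}, \sum_i c i (u i) <= \sum_i \sum_j c i j * s i j.
Proof.
move=> s0 c0; have [u [a [b [abc cu]]]] := assignment_duality c.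
exists u; rewrite cu; apply: le_trans (block_weight_ge a b) _.
apply: ler_sum => i _; apply: ler_sum => j _.
by rewrite mulrC ler_wpM2r// ge_max c0 abc.
Qed.

End BlockSums.

(** * Frobenius and operator norms, and the block inequality for a matrix *)

Lemma rank_diag_indicator (F : fieldType) n (K : {set 'I_n}) :
  (\rank (diag_mx (\row_i (i \in K)%:R : 'rV[F]_n)) <= #|K|)%N.
Proof.
have -> : diag_mx (\row_i (i \in K)%:R : 'rV[F]_n) = \sum_(i in K) delta_mx i i.
  apply/matrixP => i j; rewrite !mxE summxE big_mkcond (bigD1 i)//= big1; last first.
    by move=> k ki; case: ifP => // _; rewrite mxE eq_sym (negPf ki).
  by rewrite addr0 mxE; case: ifP => _; rewrite ?eqxx ?mul0rn// eq_sym.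
rewrite -sum1_card; elim/big_rec2: _ => [|i y1 y2 _ IH]; first by rewrite mxrank0.
by apply: leq_trans (mxrank_add _ _) _; rewrite mxrank_delta ltnS.
Qed.

Section Frobenius.
Local Open Scope sesquilinear_scope.
Local Open Scope complex_scope.
Variable R : realType.

(** Squared norms avoid square roots and add up over columns, which reduces matrix bounds to vector
    bounds. *)
Definition frob2 m n (A : 'M[R[i]]_(m, n)) : R :=
  \sum_i \sum_j normc (A i j) ^+ 2.

Lemma frob2_ge0 m n (A : 'M[R[i]]_(m, n)) : 0 <= frob2 A.
Proof. by rewrite sumr_ge0// => i _; rewrite sumr_ge0// => j _; rewrite sqr_ge0. Qed.

Lemma sqr_frob_norm m n (A : 'M[R[i]]_(m, n)) : frob_norm A ^+ 2 = frob2 A.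
Proof. by rewrite sqr_sqrtr ?frob2_ge0. Qed.

Lemma sqr_eucl_norm n (x : 'cV[R[i]]_n) : eucl_norm x ^+ 2 = frob2 x.
Proof.
rewrite sqr_sqrtr; last by rewrite sumr_ge0// => i _; rewrite sqr_ge0.
by apply: eq_bigr => i _; rewrite big_ord1.
Qed.

Lemma frob2_eq0 m n (A : 'M[R[i]]_(m, n)) : frob2 A = 0 -> A = 0.
Proof.
move=> A0; apply/matrixP => i j; rewrite mxE; apply: eq0_normc.
have sqr0 (z : R[i]) : 0 <= normc z ^+ 2 by exact: sqr_ge0.
apply/eqP; rewrite -sqrf_eq0; apply/eqP.
have := psumr_eq0P (fun i _ => sumr_ge0 _ (fun j _ => sqr0 (A i j))) A0.
by move=> /(_ i isT)/psumr_eq0P; apply.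
Qed.

Lemma frob2_0 m n : frob2 (0 : 'M[R[i]]_(m, n)) = 0.
Proof.
by rewrite /frob2 big1// => i _; rewrite big1// => j _; rewrite mxE normc0 expr0n.
Qed.

Lemma frob2_mxtrace m n (A : 'M[R[i]]_(m, n)) : (frob2 A)%:C = \tr (A *m A^t*).
Proof.
rewrite rmorph_sum; apply: eq_bigr => i _; rewrite mxE rmorph_sum.
by apply: eq_bigr => j _; rewrite !mxE -normCK rmorphXn.
Qed.

Lemma frob2_tr m n (A : 'M[R[i]]_(m, n)) : frob2 A^T = frob2 A.
Proof.
by rewrite /frob2 exchange_big; do 2![apply: eq_bigr => ? _]; rewrite mxE.
Qed.

Lemma frob2_trC m n (A : 'M[R[i]]_(m, n)) : frob2 (A^t*) = frob2 A.
Proof.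
apply: complexI; rewrite frob2_mxtrace mxtrace_mulC trmxCK.
by rewrite -frob2_mxtrace.
Qed.

Lemma frob2_col m n (A : 'M[R[i]]_(m, n)) : frob2 A = \sum_j frob2 (col j A).
Proof.
rewrite /frob2 exchange_big; do 2![apply: eq_bigr => ? _].
by rewrite big_ord1 mxE.
Qed.

Lemma frob2_mull m n p t (Y : 'M[R[i]]_(m, n)) (M : 'M_(n, p)) :
  (forall x : 'cV_n, frob2 (Y *m x) <= t * frob2 x) ->
  frob2 (Y *m M) <= t * frob2 M.
Proof.
move=> hY; rewrite !frob2_col mulr_sumr; apply: ler_sum => j _.
by rewrite !colE -mulmxA hY.
Qed.

(** A weighted additive form of Cauchy-Schwarz; for moduli [x], [y] of paired entries it is
    [0 <= s * (x - s^-1 * y) ^+ 2]. *)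
Lemma normc_mxtrace_mul m n s (A : 'M[R[i]]_(m, n)) (B : 'M_(n, m)) : 0 < s ->
  2 * normc (\tr (A *m B)) <= s * frob2 A + s^-1 * frob2 B.
Proof.
move=> s0; rewrite -(frob2_tr B) /frob2 !mulr_sumr -big_split /=.
apply: le_trans (_ : 2 * \sum_i normc ((A *m B) i i) <= _).
  by rewrite ler_pM2l// normc_sum_le.
rewrite mulr_sumr; apply: ler_sum => i _; rewrite !mulr_sumr -big_split /= mxE.
apply: le_trans (_ : 2 * \sum_j normc (A i j * B j i) <= _).
  by rewrite ler_pM2l// normc_sum_le.
rewrite mulr_sumr; apply: ler_sum => j _; rewrite mxE normcM.
set x := normc _; set y := normc _.
rewrite -subr_ge0 (_ : _ - _ = s * (x - s^-1 * y) ^+ 2); last by field; rewrite gt_eqF.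
by rewrite mulr_ge0 ?sqr_ge0// ltW.
Qed.

(* The bound on Y passes to its adjoint: with N = M Y,
   2 |N|^2 = 2 tr (M (Y N^* )) <= t |M|^2 + |Y N^* |^2 / t <= t |M|^2 + |N|^2. *)
Lemma frob2_mulr m n p t (M : 'M[R[i]]_(p, m)) (Y : 'M_(m, n)) : 0 <= t ->
  (forall x : 'cV_n, frob2 (Y *m x) <= t * frob2 x) ->
  frob2 (M *m Y) <= t * frob2 M.
Proof.
move=> t0 hY; set N := M *m Y.
have YN : frob2 (Y *m N^t*) <= t * frob2 N by rewrite -(frob2_trC N) frob2_mull.
have NE : frob2 N = normc (\tr (M *m (Y *m N^t*))).
  rewrite mulmxA -frob2_mxtrace /normc /= expr0n addr0 sqrtr_sqr.
  by rewrite ger0_norm ?frob2_ge0.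
have [t_gt0|] := ltP 0 t; last first.
  (* The weight [t] must be invertible below. For [t = 0], the product [Y *m N^t*] vanishes, and
     [NE] yields [frob2 N = 0]. *)
  move=> t_le0; have t00 : t = 0 by apply/le_anti/andP.
  move: YN; rewrite t00 !mul0r => YN.
  have YN0 : Y *m N^t* = 0.
    by apply: frob2_eq0; apply/le_anti; rewrite YN frob2_ge0.
  by rewrite NE YN0 mulmx0 mxtrace0 normc0.
have := normc_mxtrace_mul M (Y *m N^t*) t_gt0; rewrite -NE.
have : t^-1 * frob2 (Y *m N^t*) <= frob2 N by rewrite mulrC ler_pdivrMr// mulrC.
lra.
Qed.

Lemma op_norm_ge0 m n (A : 'M[R[i]]_(m, n)) : 0 <= op_norm A.
Proof.
apply: (@le_trans _ _ (eucl_norm (A *m 0))); first exact: sqrtr_ge0.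
apply: ub_le_sup; first by case: (has_sup_op_norm A).
exists 0 => //=.
by rewrite -(@ler_pXn2r _ 2)// ?nnegrE ?sqrtr_ge0// sqr_eucl_norm frob2_0 expr1n ler01.
Qed.

Lemma frob2Z m n a (A : 'M[R[i]]_(m, n)) : frob2 (a *: A) = normc a ^+ 2 * frob2 A.
Proof.
rewrite /frob2 mulr_sumr; apply: eq_bigr => i _; rewrite mulr_sumr.
by apply: eq_bigr => j _; rewrite mxE normcM exprMn.
Qed.

Lemma frob2_op_norm m n (A : 'M[R[i]]_(m, n)) (x : 'cV_n) :
  frob2 (A *m x) <= op_norm A ^+ 2 * frob2 x.
Proof.
have [x0|x0] := eqVneq (frob2 x) 0.
  by rewrite x0 (frob2_eq0 x0) mulmx0 frob2_0 mulr0.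
have x_gt0 : 0 < frob2 x by rewrite lt_neqAle eq_sym x0 frob2_ge0.
pose e := eucl_norm x.
have eE : normc (e^-1)%:C ^+ 2 = (frob2 x)^-1.
  by rewrite /normc /= expr0n addr0 sqrtr_sqr real_normK ?num_real// exprVn sqr_eucl_norm.
have : eucl_norm (A *m ((e^-1)%:C *: x)) <= op_norm A.
  apply: ub_le_sup; first by case: (has_sup_op_norm A).
  exists ((e^-1)%:C *: x) => //=.
  rewrite -(@ler_pXn2r _ 2)// ?nnegrE ?sqrtr_ge0// sqr_eucl_norm frob2Z eE.
  by rewrite mulVf// expr1n.
rewrite -(@ler_pXn2r _ 2)// ?nnegrE ?op_norm_ge0 ?sqrtr_ge0// sqr_eucl_norm.
by rewrite -scalemxAr frob2Z eE mulrC ler_pdivrMr.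
Qed.

Lemma block_sum_ge n (t : R) (W : 'M[R[i]]_n) (I J : {set 'I_n}) :
  0 <= t -> (forall x : 'cV_n, frob2 x <= t * frob2 (W *m x)) ->
  #|I|%:R + #|J|%:R - #|'I_n|%:R <=
    \sum_(i in I) \sum_(j in J) t * normc (W i j) ^+ 2.
Proof.
move=> t0 hW.
pose D (K : {set 'I_n}) : 'M[R[i]]_n := diag_mx (\row_i (i \in K)%:R).
have DC K : D (~: K) = 1%:M - D K.
  apply/matrixP => i j; rewrite !mxE finset.in_setC.
  by case: eqP => // _; case: (_ \in K); rewrite /= ?subrr ?subr0 ?mulr1n.
have DT K : (D K)^T = D K by rewrite tr_diag_mx.
(* A row [v] satisfies [v *m N = 0] exactly when [v] is supported on [J] and [W *m v^T] on [I]; the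
   rank bound makes this kernel of dimension at least [#|I| + #|J| - n]. *)
pose N := row_mx (D (~: J)) (W^T *m D (~: I)).
have rN : (\rank N <= #|~: J| + #|~: I|)%N.
  rewrite -mxrank_tr tr_row_mx -(addsmxE _ _).
  apply: leq_trans (mxrank_adds_leqif _ _) _; rewrite !mxrank_tr leq_add ?rank_diag_indicator//.
  by apply: leq_trans (mxrankM_maxr _ _) _; exact: rank_diag_indicator.
pose X := schmidt (row_base (kermx N)).
have uX : X *m X^t* = 1%:M by apply/unitarymxP/schmidt_unitarymx/rank_leq_row.
have XN : X *m N = 0.
  apply/sub_kermxP; rewrite /X.
  by rewrite eqmx_schmidt_free ?row_base_free// eq_row_base.
move: XN; rewrite mul_mx_row -[0 in RHS]row_mx0 => /eq_row_mx[XJ XI].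
have XJ' : D J *m X^T = X^T.
  apply: trmx_inj; rewrite trmx_mul trmxK DT.
  by move: XJ; rewrite DC mulmxBr mulmx1 => /subr0_eq.
have XI' : D I *m (W *m X^T) = W *m X^T.
  apply: trmx_inj; rewrite !trmx_mul trmxK DT.
  by move: XI; rewrite DC mulmxBr mulmxBr mulmx1 mulmxA => /subr0_eq.
have frX : frob2 X = (\rank (kermx N))%:R.
  by apply: complexI; rewrite frob2_mxtrace uX mxtrace1 rmorph_nat.
(* The hypothesis on [W] is summed over the orthonormal basis formed by the rows of [X]. *)
have lower : frob2 X <= t * frob2 (W *m X^T).
  rewrite -frob2_tr !frob2_col mulr_sumr; apply: ler_sum => j _.
  by rewrite !colE -mulmxA.
(* Since [X] has orthonormal rows, [X^T] is an isometry, so the constant in [frob2_mulr] is 1. *)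
have upper : frob2 (D I *m W *m D J *m X^T) <= 1 * frob2 (D I *m W *m D J).
  apply: frob2_mulr => // x; rewrite mul1r -frob2_tr trmx_mul trmxK.
  rewrite -(frob2_tr x) -lecR !frob2_mxtrace trmx_mul map_mxM mulmxA.
  by rewrite -(mulmxA _ X) uX mulmx1.
have IJ : frob2 (D I *m W *m D J) = \sum_(i in I) \sum_(j in J) normc (W i j) ^+ 2.
  rewrite /frob2 [RHS]big_mkcond; apply: eq_bigr => i _.
  rewrite mul_mx_diag; case: ifPn => iI.
    rewrite [RHS]big_mkcond; apply: eq_bigr => j _; rewrite mul_diag_mx !mxE iI mul1r.
    by case: ifP; rewrite ?mulr1// mulr0 normc0 expr0n.
  rewrite big1// => j _; rewrite mul_diag_mx !mxE (negPf iI) !mul0r.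
  by rewrite normc0 expr0n.
move: upper; rewrite -!mulmxA XJ' XI' mul1r !mulmxA IJ => upper.
under eq_bigr do rewrite -mulr_sumr.
rewrite -mulr_sumr; apply: le_trans (ler_wpM2l t0 upper).
apply: le_trans lower; rewrite frX lerBlDr -!natrD ler_nat card_ord mxrank_ker.
have := cardsC I; have := cardsC J; have := rank_leq_row N; rewrite card_ord; lia.
Qed.

End Frobenius.

Theorem theorem3p5 (R : realType) (m n : nat) (hm : (1 <= m)%N) (hn : (1 <= n)%N)
  (A B : 'I_m -> 'M[R[i]]_n)
  (hAdiag : forall k, diagonalizable (A k))
  (hBdiag : forall k, diagonalizable (B k))
  (hAcomm : forall k l, A k *m A l = A l *m A k)
  (hBcomm : forall k l, B k *m B l = B l *m B k)
  (P Q : 'M[R[i]]_n) (hP : P \in unitmx) (hQ : Q \in unitmx)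
  (alpha beta : 'I_m -> 'I_n -> R[i])
  (hPA : forall k, P *m A k *m invmx P = diag_mx (\row_j alpha k j))
  (hQB : forall k, Q *m B k *m invmx Q = diag_mx (\row_j beta k j))
  (hAunit : forall k, A k \in unitmx) :
  exists pi : 'S_n,
    \sum_(j < n) \sum_(k < m)
      normc ((alpha k j - beta k (pi j)) / alpha k j) ^+ 2
    <= cond_number P ^+ 2 * cond_number Q ^+ 2 *
       \sum_(k < m) frob_norm (invmx (A k) *m (B k - A k)) ^+ 2.
Proof.
pose M k := invmx (A k) *m (B k - A k).
pose W := P *m invmx Q; pose X k := P *m M k *m invmx Q.
have a0 k i : alpha k i != 0.
  have : P *m A k *m invmx P \in unitmx by rewrite !unitmx_mul hP hAunit unitmx_inv.
  rewrite hPA unitmxE det_diag unitfE => /prodf_neq0/(_ i isT).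
  by rewrite mxE.
have XE k i j : X k i j = - ((alpha k i - beta k j) / alpha k i) * W i j.
  (* Multiplying by the diagonal form of [A k] removes the inverse of [A k]; afterwards the nonzero
     [alpha k i] is cancelled entrywise. *)
  have : diag_mx (\row_j alpha k j) *m X k =
      W *m diag_mx (\row_j beta k j) - diag_mx (\row_j alpha k j) *m W.
    rewrite -hPA -hQB /X /W /M !mulmxA !mulmxKV// mulmxK//.
    by rewrite mulmxBr mulmxBl.
  move: (X k) (W) => Y V /matrixP/(_ i j).
  rewrite !mul_diag_mx mul_mx_diag !mxE => YV.
  by apply: (mulfI (a0 k i)); rewrite YV; field.
pose s i j := (op_norm Q * op_norm (invmx P)) ^+ 2 * normc (W i j) ^+ 2.
pose c i j := \sum_(k < m) normc ((alpha k i - beta k j) / alpha k i) ^+ 2.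
have hW (x : 'cV_n) :
    frob2 x <= (op_norm Q * op_norm (invmx P)) ^+ 2 * frob2 (W *m x).
  (* The inverse of [W] is [Q *m invmx P], whence the constant. *)
  have {1}-> : x = Q *m (invmx P *m (W *m x)).
    by rewrite /W !mulmxA mulmxKV// mulmxV// mul1mx.
  apply: le_trans (frob2_op_norm _ _) _; rewrite exprMn -[leRHS]mulrA.
  by rewrite ler_wpM2l ?sqr_ge0// frob2_op_norm.
have [] := @assignment_le_pairing _ _ s _ c.
- by move=> I J; apply: block_sum_ge hW; exact: sqr_ge0.
- by move=> i j; rewrite mulr_ge0 ?sqr_ge0.
- by move=> i j; rewrite sumr_ge0// => k _; exact: sqr_ge0.
move=> u hu; exists u; apply: le_trans hu _.
have -> : \sum_i \sum_j c i j * s i j =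
    (op_norm Q * op_norm (invmx P)) ^+ 2 * \sum_(k < m) frob2 (X k).
  rewrite /frob2 [in RHS]exchange_big /= mulr_sumr; apply: eq_bigr => i _.
  rewrite [in RHS]exchange_big /= mulr_sumr; apply: eq_bigr => j _.
  rewrite /c /s mulrCA mulr_suml; congr (_ * _); apply: eq_bigr => k _.
  by rewrite XE [in RHS]normcM normcN exprMn.
have hX k : frob2 (X k) <= op_norm P ^+ 2 * op_norm (invmx Q) ^+ 2 *
    frob_norm (M k) ^+ 2.
  rewrite sqr_frob_norm mulrAC [leRHS]mulrC.
  apply: le_trans (frob2_mulr _ _ (frob2_op_norm (invmx Q))) _; first exact: sqr_ge0.
  by rewrite ler_wpM2l ?sqr_ge0// frob2_mull// => x; exact: frob2_op_norm.
(* The bound for the inverse of [W] supplies the norms of [Q] and [invmx P], the bound [hX] those of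
   [P] and [invmx Q]; together they form both condition numbers. *)
have regroup (p p' q q' : R) :
    (p * p') ^+ 2 * (q * q') ^+ 2 = (q * p') ^+ 2 * (p ^+ 2 * q' ^+ 2) by ring.
rewrite /cond_number regroup.
rewrite -[leRHS]mulrA; apply: ler_wpM2l; first exact: sqr_ge0.
by rewrite mulr_sumr; apply: ler_sum => k _; exact: hX.
Qed.
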